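(* If $\mathfrak{b}<\mathfrak{b}(\mathcal{J},\mathrm{Fin},\mathrm{Fin})$ for some ideal $\mathcal{J}$ on $\omega$, then there is a weak P-ideal $\mathcal{I}$ such that $$\mathfrak{b}(\mathcal{I},\mathcal{I},\mathcal{I})\le\mathfrak{b}=\mathfrak{b}(\mathcal{I},\mathrm{Fin},\mathrm{Fin})<\mathfrak{b}(\mathcal{I},\mathcal{I},\mathrm{Fin}).$$
   Context: An ideal on a countable infinite set $X$ is a family $\mathcal{I}\subseteq\mathcal{P}(X)$ closed under finite unions and subsets, containing all finite subsets, with $X\notin\mathcal{I}$; $\mathrm{Fin}$ denotes the ideal of finite subsets of the relevant set. $\mathcal{I}$ is a weak P-ideal if for every countable $\mathcal{A}\subseteq\mathcal{I}$ there is $B\notin\mathcal{I}$ with $A\cap B$ finite for all $A\in\mathcal{A}$. $\mathfrak{b}$ is the bounding number. For an ideal $\mathcal{K}$ on $X$, $\widehat{\mathcal{P}}_{\mathcal{K}}$ is the family of sequences $\langle A_n:n\in\omega\rangle$ of pairwise disjoint members of $\mathcal{K}$, and $\mathcal{P}_{\mathcal{K}}$ those with union $X$. For ideals on $X$: $\mathfrak{b}(\mathcal{I},\mathcal{J},\mathcal{K})=\min\{|\mathcal{E}|:\mathcal{E}\subseteq\widehat{\mathcal{P}}_{\mathcal{K}},\ \forall\langle A_n\rangle\in\mathcal{P}_{\mathcal{J}}\ \exists\langle E_n\rangle\in\mathcal{E}\ \bigcup_n(A_n\cap\bigcup_{i\le n}E_i)\notin\mathcal{I}\}$, with $\min\emptyset=\mathfrak{c}^+$.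 *)

(* Defs.v *)
From mathcomp Require Import all_boot all_order.
From mathcomp Require Import boolp classical_sets functions cardinality.

Set Implicit Arguments.
Unset Strict Implicit.
Unset Printing Implicit Defensive.

Local Open Scope classical_set_scope.
Local Open Scope card_scope.

Definition card_lt T U (A : set T) (B : set U) : Prop :=
  A #<= B /\ ~ (B #<= A).
Notation "A '#<' B" := (card_lt A B) (at level 79) : card_scope.

(* A cardinal is represented by a set of that size.  Every cardinal considered
   here is at most the successor of the continuum, hence at most 2 ^ c, so that
   a representative always exists among the subsets of P(P(nat)); which one is
   chosen is immaterial since cardinals are only compared by #=, #<= and #<. *)
Definition cardinal : Type := set (set (set nat)).

Definition is_min_card T (C : set (set T)) (k : cardinal) : Prop :=
  (exists2 E, C E & k #= E) /\ (forall E, C E -> k #<= E).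

(* min { |E| : E in C }; only meaningful for C nonempty (see min_cardP) *)
Definition min_card T (C : set (set T)) : cardinal := get (is_min_card C).

Definition continuum_succ : cardinal :=
  min_card [set A : set (set (set nat)) | [set: set nat] #< A].

Definition le_star (f g : nat -> nat) : Prop :=
  exists N, forall n, N <= n -> f n <= g n.

Definition unbounded_family (F : set (nat -> nat)) : Prop :=
  ~ exists g, forall f, F f -> le_star f g.

Definition bounding_number : cardinal := min_card unbounded_family.

Definition countably_infinite (X : Type) : Prop :=
  countable [set: X] /\ infinite_set [set: X].

Record ideal (X : Type) (I : set (set X)) : Prop := Ideal {
  ideal_setU : forall A B, I A -> I B -> I (A `|` B) ;
  ideal_subset : forall A B, A `<=` B -> I B -> I A ;
  ideal_finite : forall A, finite_set A -> I A ;
  ideal_proper : ~ I [set: X] }.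

Definition Fin (X : Type) : set (set X) := [set A | finite_set A].
Arguments Fin {X}.

Definition weak_P_ideal (X : Type) (I : set (set X)) : Prop :=
  ideal I /\
  forall F : set (set X), countable F -> F `<=` I ->
    exists2 B, ~ I B & forall A, F A -> finite_set (A `&` B).

Definition disjoint_seq (X : Type) (K : set (set X)) : set (nat -> set X) :=
  [set A | (forall n, K (A n)) /\ trivIset [set: nat] A].

Definition partition_seq (X : Type) (K : set (set X)) : set (nat -> set X) :=
  [set A | disjoint_seq K A /\ \bigcup_n A n = [set: X]].

Definition b_witness (X : Type) (I J K : set (set X))
    (E : set (nat -> set X)) : Prop :=
  E `<=` disjoint_seq K /\
  forall A, partition_seq J A ->
    exists2 e, E e &
      ~ I (\bigcup_n (A n `&` \bigcup_(i in [set i | i <= n]) e i)).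

Definition b_ideals (X : Type) (I J K : set (set X)) : cardinal :=
  if `[< b_witness I J K !=set0 >] then min_card (b_witness I J K)
  else continuum_succ.

Lemma ex_min_card (T : pointedType) (C : set (set T)) : C !=set0 ->
  exists2 E, C E & forall E', C E' -> E #<= E'.
Proof.
move=> [E0 CE0].
pose P (S : set (set T -> T)) :=
  (forall h E, S h -> C E -> E (h E)) /\
  (forall h k E, S h -> S k -> C E -> h E = k E -> h = k).
have [|S [[SE Sinj] Smax]] := @Zorn_bigcup _ P.
  move=> F FP Ftot; split=> [h E [S FS Sh] CE|h k E [S FS Sh] [S' FS' S'k] CE].
    exact: (FP _ FS).1 CE.
  have [SS'|S'S] := Ftot _ _ FS FS'.
    exact: (FP _ FS').2 (SS' _ Sh) S'k CE.
  exact: (FP _ FS).2 Sh (S'S _ S'k) CE.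
have [E CE Esurj] : exists2 E, C E & forall x, E x -> exists2 h, S h & h E = x.
  apply: contrapT => /forall2NP noE.
  have /choice[h0 h0P] : forall E, exists x, C E ->
      E x /\ ~ exists2 h, S h & h E = x.
    move=> E; have [nCE|nE] := noE E; first by exists point.
    by move/existsNP: nE => [x /not_implyP Hx]; exists x.
  have nSh0 : ~ S h0 by move=> Sh0; apply: (h0P _ CE0).2; exists h0.
  apply: (Smax (S `|` [set h0])).
    by split=> [h Sh|/(_ h0)]; [left|move=> /(_ (or_intror erefl))].
  split=> [h E [Sh|->] CE|h k E].
  - exact: SE Sh CE.
  - exact: (h0P _ CE).1.
  - move=> [Sh|->] [Sk|->] CE // e.
    + exact: Sinj e.
    + by case: (h0P _ CE).2; exists h.
    + by case: (h0P _ CE).2; exists k.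
exists E => // E' CE'.
have /choice[g gP] : forall x, exists h, E x -> S h /\ h E = x.
  move=> x; have [Ex|nEx] := pselect (E x).
    by have [h Sh hE] := Esurj x Ex; exists h.
  by exists (fun=> point).
have gfun x : E x -> E' (g x E') by move=> Ex; exact: SE (gP _ Ex).1 CE'.
have ginj : {in E &, injective (fun x => g x E')}.
  move=> x y /set_mem Ex /set_mem Ey /= e.
  have [Sx gx] := gP _ Ex; have [Sy gy] := gP _ Ey.
  by rewrite -gx -gy (Sinj _ _ _ Sx Sy CE' e).
rewrite -(card_le_eql (inj_card_eq ginj)); apply: subset_card_le.
by move=> _ [x Ex <-]; exact: gfun.
Qed.

Lemma min_cardP (T : pointedType) (C : set (set T)) :
  [set: T] #<= [set: set (set nat)] -> C !=set0 -> is_min_card C (min_card C).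
Proof.
move=> /pcard_leTP[f] /ex_min_card[E CE Emin].
apply: getPex; exists (f @` E).
have fE : f @` E #= E by apply: inj_card_eq => x y _ _; apply: inj; rewrite inE.
split; first by exists E.
by move=> E' CE'; rewrite (card_le_eql fE); exact: Emin.
Qed.

Lemma continuum_succP :
  is_min_card [set A : set (set (set nat)) | [set: set nat] #< A]
              continuum_succ.
Proof.
apply: min_cardP => //; exists setT; split.
  apply/pcard_leTP/injPex; exists (fun A => [set A]) => A B _ _ e.
  by have : [set A] A by []; rewrite e.
move=> /pcard_leTP[f].
pose D : set (set nat) := [set f A | A in [set A | ~ A (f A)]].
have nDf : ~ D (f D).
  move=> DfD; have [A nA fA] := DfD.
  have AD : A = D by apply: inj fA; rewrite inE.
  by apply: nA; rewrite AD.
by apply: (nDf); exists D.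
Qed.

Lemma card_le_seq_set (X : Type) : countable [set: X] ->
  [set: nat -> set X] #<= [set: set (set nat)].
Proof.
move=> /pcard_leTP[g]; apply/pcard_leTP; apply/injPex.
pose code (A : nat -> set X) : set (set nat) :=
  [set s | exists n x, A n x /\ s = [set pickle (n, g x)]].
have codeP A n x : code A [set pickle (n, g x)] <-> A n x.
  split=> [[m [y [Amy e]]]|Anx]; last by exists n, x.
  have : [set pickle (n, g x)] (pickle (n, g x)) by [].
  rewrite e => /(pcan_inj pickleK)[-> gxy].
  by have -> : x = y by apply: inj gxy; rewrite inE.
exists code => A B _ _ e; apply/funext => n; apply/seteqP.
by split=> x /codeP; [rewrite e|rewrite -e] => /codeP.
Qed.

Lemma b_idealsP (X : Type) (I J K : set (set X)) : countable [set: X] ->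
  b_witness I J K !=set0 -> is_min_card (b_witness I J K) (b_ideals I J K).
Proof.
move=> cX neW; rewrite /b_ideals asboolT //.
by apply: min_cardP neW; exact: card_le_seq_set.
Qed.

Lemma bounding_numberP : is_min_card unbounded_family bounding_number.
Proof.
apply: min_cardP.
  have c : countable [set: nat] by exact: card_lexx.
  apply: card_le_trans (card_le_seq_set c).
  apply/pcard_leTP/injPex; exists (fun f n => [set f n]) => f g _ _ e.
  apply/funext => n; have : [set g n] (f n) by rewrite -(congr1 (@^~ n) e).
  by [].
exists setT => -[g /(_ (fun n => (g n).+1) I)[N /(_ N (leqnn N))]].
by rewrite ltnn.
Qed.

(* Main.v *)
Require Import Defs.
From mathcomp Require Import all_boot all_order.
From mathcomp Require Import boolp classical_sets functions cardinality.

Set Implicit Arguments.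
Unset Strict Implicit.
Unset Printing Implicit Defensive.

Local Open Scope classical_set_scope.
Local Open Scope card_scope.

(** From [J] form the ideal [I] on [nat * nat] of the sets whose nonempty
columns are indexed by a member of [J] and all but finitely many of whose
columns are finite.  The graph of a function is not in [I], and countably many
members of [I] are almost disjoint from the graph of a fast enough function, so
[I] is a weak P-ideal.

Identify a partition with the function [r] sending a point to the index of its
block; the set in the definition of [b] is then [{x | e x <= r x}].
If [e] is finite-to-one on [nat * nat] and [r (n, m) = h n] with [h]
finite-to-one, then [{e <= r}] has finite columns, and its nonempty columns are
the [n] with [min_m e (n, m) <= h n]; hence b(I,I,Fin) >= b(J,Fin,Fin) > b.
Finally take [b] many finite-to-one functions [q] on [nat] such that every
finite-to-one function is infinitely often above one of them.  The functions
[max n (q m)] witness b(I,Fin,Fin) <= b, and the functions [q n] witness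
b(I,I,I) <= b. *)

Lemma finite_set_bounded T (A : set T) (p : T -> nat) :
  finite_set A -> exists N, forall x, A x -> p x < N.
Proof.
move=> /(finite_image p)/finite_seqP[s As].
exists (\max_(i <- s) i).+1 => x Ax; rewrite ltnS.
have : [set p y | y in A] (p x) by exists x.
by rewrite As /= => ps; exact: (@leq_bigmax_seq _ s xpredT id).
Qed.

Lemma bounded_finite_set (T : countType) (A : set T) N :
  (forall x, A x -> pickle x < N) -> finite_set A.
Proof.
move=> AN; apply: (@sub_finite_set _ _ (pickle @^-1` `I_N)); first exact: AN.
apply: finite_preimage (finite_II N) => x y _ _.
exact: (pcan_inj pickleK).
Qed.

(** * Partitions as fibres of functions *)

Definition fibres X (r : X -> nat) : nat -> set X := fun i => [set x | r x = i].

Definition overlap X (A e : nat -> set X) : set X :=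
  \bigcup_n (A n `&` \bigcup_(i in [set i | i <= n]) e i).

Section Fibres.
Variables (X : Type) (r : X -> nat).

Lemma fibres_disjoint_seq (K : set (set X)) :
  (forall i, K (fibres r i)) -> disjoint_seq K (fibres r).
Proof. by move=> Kr; split=> // i j _ _ [x [<- <-]]. Qed.

Lemma fibres_partition_seq (K : set (set X)) :
  (forall i, K (fibres r i)) -> partition_seq K (fibres r).
Proof.
move=> Kr; split; first exact: fibres_disjoint_seq.
by apply/seteqP; split=> // x _; exists (r x).
Qed.

Lemma fibres_le (K : set (set X)) :
  (forall A B, K A -> K B -> K (A `|` B)) -> (forall i, K (fibres r i)) ->
  forall k, K [set x | r x <= k].
Proof.
move=> KU Kr; elim=> [|k IHk].
  suff -> : [set x | r x <= 0] = fibres r 0 by [].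
  by apply/seteqP; split=> x /=; rewrite leqn0 => /eqP.
suff -> : [set x | r x <= k.+1] = [set x | r x <= k] `|` fibres r k.+1.
  exact: KU.
apply/seteqP; split=> x /=.
  by rewrite leq_eqVlt => /predU1P[|]; [right|left].
by case=> [/leqW|->].
Qed.

Lemma overlap_fibresP (e : nat -> set X) x :
  overlap (fibres r) e x <-> exists2 i, i <= r x & e i x.
Proof.
split=> [[n _ [<- [i ilen eix]]]|[i ile eix]]; first by exists i.
by exists (r x) => //; split=> //; exists i.
Qed.

Lemma overlap_fibres (s : X -> nat) x :
  overlap (fibres r) (fibres s) x <-> s x <= r x.
Proof.
rewrite overlap_fibresP; split=> [[i le_ir /= ->//]|le_sr].
by exists (s x).
Qed.

End Fibres.

Lemma partition_seq_fibres X (K : set (set X)) A : partition_seq K A ->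
  exists2 r, A = fibres r & forall i, K (fibres r i).
Proof.
move=> [[KA trivA] covA].
have /choice[r Ar] : forall x, exists n, A n x.
  move=> x; have [n _ Anx] : (\bigcup_n A n) x by rewrite covA.
  by exists n.
suff Afib : A = fibres r by exists r => // i; rewrite -Afib.
apply/funext => n; apply/seteqP; split=> [x Anx|x <- //].
by apply: trivA => //; exists x.
Qed.

(** * Finite-to-one functions from unbounded families *)

Section Inverse.
Variable f : nat -> nat.

Fact quasi_inverse_subproof m : exists k, m <= f k + k.
Proof. by exists m; rewrite leq_addl. Qed.

(** The summand [k] makes the minimum exist for arbitrary [f], and the fibre at [k] is bounded by
    [f k + k], hence finite. *)
Definition quasi_inverse m := ex_minn (quasi_inverse_subproof m).

Lemma quasi_inverse_le m k : m <= f k + k -> quasi_inverse m <= k.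
Proof. by rewrite /quasi_inverse; case: ex_minnP => j _; apply. Qed.

Lemma quasi_inverse_ge m : m <= f (quasi_inverse m) + quasi_inverse m.
Proof. by rewrite /quasi_inverse; case: ex_minnP. Qed.

Lemma finite_quasi_inverse_le k : finite_set [set m | quasi_inverse m <= k].
Proof.
apply: (@fibres_le _ quasi_inverse Fin) => [A B fA fB|i].
  by rewrite /Fin /= finite_setU.
apply: sub_finite_set (finite_II (f i + i).+1) => m <-.
exact: quasi_inverse_ge.
Qed.

End Inverse.

(** Let [a m >= k] for [m >= g k]. If [quasi_inverse f] stayed above [a] beyond [N], then
    [f k <= g k] for all [k >= N]: otherwise [m = g k + k] has [quasi_inverse f m <= k <= a m]. So
    [g] would dominate [F]. *)
Lemma unbounded_quasi_inverse F (a : nat -> nat) : unbounded_family F ->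
  (forall k, exists N, forall m, N <= m -> k <= a m) ->
  exists2 f, F f & forall N, exists2 m, N <= m & quasi_inverse f m <= a m.
Proof.
move=> unbF /choice[g gP]; apply: contrapT => /forall2NP noF.
apply: unbF; exists g => f Ff; have [//|/existsNP[N NP]] := noF f.
exists N => k leNk; rewrite leqNgt; apply/negP => lt_gf.
apply: NP; exists (g k + k); first exact: leq_trans leNk (leq_addl _ _).
apply: (@leq_trans k); last by apply: gP; exact: leq_addr.
by apply: quasi_inverse_le; rewrite leq_add2r ltnW.
Qed.

(** * Comparing cardinals with the bounding number *)

(** Each [e] in [W] yields a bound [B e k] on the codes of the points in its blocks up to [k]. If
    one [g] dominated all these bounds, a slow partition built from [g] would have finite overlap
    with every [e]. *)
Lemma bounding_le_witness (X : countType) (I : set (set X)) W :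
  Fin `<=` I -> b_witness I Fin Fin W -> bounding_number #<= W.
Proof.
move=> FinI [WFin Wit].
have /choice[B BP] : forall e : nat -> set X, exists B : nat -> nat,
    W e -> forall k i x, i <= k -> e i x -> pickle x <= B k.
  move=> e; have [We|nWe] := pselect (W e); last by exists id.
  have [efin _] := WFin _ We.
  have /choice[B BP] k : exists N, forall i x, i <= k -> e i x -> pickle x <= N.
    have : finite_set (\bigcup_(i in `I_k.+1) e i).
      by apply: bigcup_finite => [|i _]; [exact: finite_II|exact: efin].
    move=> /(finite_set_bounded pickle)[N NP]; exists N => i x leik eix.
    by apply/ltnW/NP; exists i.
  by exists B.
suff unbB : unbounded_family (B @` W).
  apply: card_le_trans (bounding_numberP.2 _ unbB) _; exact: card_image_le.
move=> [g gP].
(* The shift gives a strict inequality: a point of block [j.+1] of [e] with code at most [g j.+1]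
   has [r x <= j], so it lies outside the overlap. *)
pose r (x : X) := quasi_inverse (fun k => g k.+1) (pickle x).
have /Wit[e We] : partition_seq Fin (fibres r).
  apply: fibres_partition_seq => k.
  apply: (@bounded_finite_set _ _ (g k.+1 + k).+1) => x <-.
  by rewrite ltnS; exact: quasi_inverse_ge.
apply; apply: FinI.
have [N NP] : le_star (B e) g by apply: gP; exists e.
have efin : finite_set (\bigcup_(i in `I_N.+1) e i).
  apply: bigcup_finite => [|i _]; first exact: finite_II.
  exact: (WFin _ We).1.
apply: sub_finite_set efin => x /overlap_fibresP[i le_ir eix].
exists i => //=; rewrite ltnS leqNgt; apply/negP => ltNi.
case: i ltNi eix le_ir => // i ltNi eix; apply/negP; rewrite -ltnNge ltnS.
apply: quasi_inverse_le; apply: leq_trans (leq_addr _ _).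
apply: leq_trans (NP _ (ltnW ltNi)).
by apply: BP eix.
Qed.

Lemma card_fun_nat_le : [set: nat -> nat] #<= [set: set nat].
Proof.
apply/pcard_leTP/injPex.
exists (fun f => [set k | exists n, k = pickle (n, f n)]) => f g _ _ e.
apply/funext => n.
have : [set k | exists n, k = pickle (n, f n)] (pickle (n, f n)) by exists n.
by rewrite e => -[m /(pcan_inj pickleK)[-> ->]].
Qed.

(** Settles the case in which no witness exists and the minimum defaults to the successor of the
    continuum. *)
Lemma bounding_lt_continuum_succ : bounding_number #< continuum_succ.
Proof.
have bc : bounding_number #<= [set: set nat].
  have [[F _ bF] _] := bounding_numberP.
  rewrite (card_le_eql bF); apply: card_le_trans card_fun_nat_le.
  exact: subset_card_le.
have [[E [cE nEc] sE] _] := continuum_succP.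
split; first by rewrite (card_le_eqr sE); exact: card_le_trans cE.
by rewrite (card_le_eql sE) => Eb; apply: nEc; exact: card_le_trans bc.
Qed.

Lemma b_ideals_le_image (X : Type) (I K L : set (set X)) T (F : set T)
    (e : T -> nat -> set X) :
  countable [set: X] -> b_witness I K L (e @` F) -> b_ideals I K L #<= F.
Proof.
move=> cX wF; have [|_ min_b] := @b_idealsP _ I K L cX.
  by exists (e @` F).
exact: card_le_trans (min_b _ wF) (card_image_le _ _).
Qed.

(** * The column ideal and its weak P-property *)

Section ColumnIdeal.
Variable J : set (set nat).
Hypothesis idJ : ideal J.

(** The intersection of the Fubini products [J ⊗ {∅}] and [Fin ⊗ Fin]. *)
Definition column_ideal : set (set (nat * nat)) :=
  [set A | J [set n | exists m, A (n, m)] /\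
           exists N, forall n, N <= n -> finite_set [set m | A (n, m)]].

Lemma finite_column (A : set (nat * nat)) n :
  finite_set A -> finite_set [set m | A (n, m)].
Proof.
by move=> finA; apply: finite_preimage finA => x y _ _ [].
Qed.

Lemma column_ideal_finite A : finite_set A -> column_ideal A.
Proof.
move=> finA; split; last by exists 0 => n _; exact: finite_column.
apply: (ideal_finite idJ); apply: sub_finite_set (finite_image fst finA).
by move=> n [m Anm]; exists (n, m).
Qed.

Lemma column_ideal_ideal : ideal column_ideal.
Proof.
split.
- move=> A B [JA [N AN]] [JB [M BM]]; split.
    apply: (ideal_subset idJ) (ideal_setU idJ JA JB).
    by move=> n [m [Am|Bm]]; [left|right]; exists m.
  exists (maxn N M) => n; rewrite geq_max => /andP[leNn leMn].
  have : finite_set ([set m | A (n, m)] `|` [set m | B (n, m)]).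
    by rewrite finite_setU; split; [exact: AN|exact: BM].
  exact: sub_finite_set.
- move=> A B AB [JB [M BM]]; split.
    by apply: (ideal_subset idJ) JB => n [m /AB]; exists m.
  by exists M => n /BM; apply: sub_finite_set => m /AB.
- exact: column_ideal_finite.
- move=> [JT _]; apply: (ideal_proper idJ); apply: (ideal_subset idJ) JT.
  by move=> n _; exists 0.
Qed.

(** Thanks to this, a finite-to-one function of the first coordinate alone has its fibres in the
    ideal, although the nonempty ones are infinite. *)
Lemma column_ideal_columns (S : set nat) :
  finite_set S -> column_ideal [set x | S x.1].
Proof.
move=> finS; split.
  by apply: (ideal_subset idJ) (ideal_finite idJ finS) => n [].
have [N NP] := finite_set_bounded id finS; exists N => n leNn.
by apply: (@sub_finite_set _ _ set0) => // m /= /NP; rewrite /= ltnNge leNn.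
Qed.

Lemma graph_notin_column_ideal (g : nat -> nat) :
  ~ column_ideal [set x | x.2 = g x.1].
Proof.
move=> [JT _]; apply: (ideal_proper idJ); apply: (ideal_subset idJ) JT.
by move=> n _; exists (g n).
Qed.

Lemma column_ideal_weak_P : weak_P_ideal column_ideal.
Proof.
split; first exact: column_ideal_ideal.
move=> F /countable_injP[c cinj] FI.
(* Diagonalisation: [g n] exceeds column [n] of every [A] with code at most [n] whose column [n] is
   finite. From [maxn N (c A)] on, the graph of [g] therefore misses [A]. *)
have /choice[g gP] n : exists N, forall A, F A -> c A <= n ->
    finite_set [set m | A (n, m)] -> forall m, A (n, m) -> m < N.
  pose D := F `&` [set A | c A <= n /\ finite_set [set m | A (n, m)]].
  have finD : finite_set D.
    rewrite -(@eq_finite_set _ _ (c @` D)).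
      by apply: sub_finite_set (finite_II n.+1) => _ [A [_ [cA _]] <-].
    apply: inj_card_eq => A B /set_mem[FA _] /set_mem[FB _].
    by apply: cinj; exact: mem_set.
  have : finite_set (\bigcup_(A in D) [set m | A (n, m)]).
    by apply: bigcup_finite => // A [_ []].
  move=> /(finite_set_bounded id)[N NP]; exists N => A FA cA finA m Am.
  by apply: NP; exists A.
exists [set x | x.2 = g x.1]; first exact: graph_notin_column_ideal.
move=> A FA; have [_ [N AN]] := FI _ FA.
have := finite_image (fun n => (n, g n)) (finite_II (maxn N (c A))).
apply: sub_finite_set.
move=> [n m] [/= Anm m_gn]; exists n; last by rewrite m_gn.
rewrite /= ltnNge geq_max; apply/negP => /andP[leNn lecn].
by have := gP n A FA lecn (AN n leNn) m Anm; rewrite m_gn ltnn.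
Qed.

(** * Upper bounds from an unbounded family *)

Lemma b_column_ideal_Fin_Fin_witness F : unbounded_family F ->
  b_witness column_ideal Fin Fin
    [set fibres (fun x => maxn x.1 (quasi_inverse f x.2)) | f in F].
Proof.
move=> unbF; pose e f (x : nat * nat) := maxn x.1 (quasi_inverse f x.2).
split=> [_ [f Ff <-]|A /partition_seq_fibres[r -> finr]].
  apply: fibres_disjoint_seq => k.
  apply: sub_finite_set
    (finite_setX (finite_II k.+1) (finite_quasi_inverse_le f k)).
  by move=> [n m] <-; split; rewrite /= ?ltnS ?leq_maxl ?leq_maxr.
have finr_le k : finite_set [set x | r x <= k].
  by apply: (@fibres_le _ r Fin) => // A' B' fA fB; rewrite /Fin /= finite_setU.
(* [a m] is the minimum of [r] on the points [(n, m)] with [n <= m]; it tends to infinity because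
   [r] is finite-to-one. *)
have /choice[a aP] m : exists k,
    (exists2 n, n <= m & r (n, m) = k) /\ forall n, n <= m -> k <= r (n, m).
  have ex : exists k, `[< exists2 n, n <= m & r (n, m) = k >].
    by exists (r (0, m)); apply/asboolP; exists 0.
  case: (ex_minnP ex) => k /asboolP kP kmin; exists k; split=> // n lenm.
  by apply: kmin; apply/asboolP; exists n.
have [k|f Ff fP] := @unbounded_quasi_inverse F a unbF.
  have [N NP] := finite_set_bounded snd (finr_le k).
  exists N => m leNm; rewrite leqNgt; apply/negP => lt_ak.
  have [[n _ rnm] _] := aP m; have /NP : r (n, m) <= k by rewrite rnm ltnW.
  by rewrite ltnNge leNm.
exists (fibres (e f)); first by exists f.
rewrite -/(overlap _ _) => -[JT _].
(* The overlap meets every column [n]: pick [m >= n] with [quasi_inverse f m <= a m <= r (n, m)],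
   large enough that also [n <= r (n, m)]. *)
apply: (ideal_proper idJ); apply: (ideal_subset idJ) JT => n _.
have [N NP] := finite_set_bounded snd (finr_le n).
have [m] := fP (maxn n N); rewrite geq_max => /andP[lenm leNm] qm.
exists m; apply/overlap_fibres; rewrite geq_max /=; apply/andP; split.
  by rewrite leqNgt; apply/negP => /ltnW/NP; rewrite ltnNge leNm.
by apply: leq_trans qm _; exact: (aP m).2.
Qed.

Lemma b_column_ideal_self_le :
  b_ideals column_ideal column_ideal column_ideal #<= bounding_number.
Proof.
have [[F unbF bF] _] := bounding_numberP; rewrite (card_le_eqr bF).
pose e f (x : nat * nat) := quasi_inverse f x.1.
apply: (@b_ideals_le_image _ _ _ _ _ _ (fun f => fibres (e f))) => //.
split=> [_ [f Ff <-]|A /partition_seq_fibres[r -> Ir]].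
  apply: fibres_disjoint_seq => k.
  apply: (@column_ideal_columns [set n | quasi_inverse f n = k]).
  by apply: sub_finite_set (finite_quasi_inverse_le f k) => n /= ->.
have Ir_le k : column_ideal [set x | r x <= k].
  by apply: fibres_le => //; exact: ideal_setU column_ideal_ideal.
pose fin n k := finite_set [set m | r (n, m) < k].
(* [a n] is the largest [k <= n] for which [r < k] only finitely often on column [n]. The cap [n]
   ensures that a maximum exists, and [a] tends to infinity because each [{r <= k}] is in the
   ideal. *)
have /choice[a aP] n :
    exists k, fin n k /\ forall j, j <= n -> fin n j -> j <= k.
  have ex : exists k, (k <= n) && `[< fin n k >].
    exists 0; apply/asboolP; rewrite /fin; exact: (@sub_finite_set _ _ set0).
  have ub k : (k <= n) && `[< fin n k >] -> k <= n by case/andP.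
  case: (ex_maxnP ex ub) => k /andP[_ /asboolP finnk] kmax.
  exists k; split=> // j lejn finj.
  by apply: kmax; rewrite lejn; apply/asboolP.
have [k|f Ff fP] := @unbounded_quasi_inverse F a unbF.
  have [_ [N NP]] := Ir_le k; exists (maxn N k) => n.
  rewrite geq_max => /andP[leNn lekn]; apply: (aP n).2 => //.
  by apply: sub_finite_set (NP n leNn) => m /ltnW.
exists (fibres (e f)); first by exists f.
rewrite -/(overlap _ _) => -[_ [N NP]].
(* Here the overlap leaves the ideal through infinite columns: when [quasi_inverse f n <= a n], it
   contains all but finitely many points of column [n]. *)
have [n leNn qn] := fP N; apply: infinite_nat.
have : finite_set ([set m | r (n, m) < a n] `|`
                   [set m | overlap (fibres r) (fibres (e f)) (n, m)]).
  by rewrite finite_setU; split; [exact: (aP n).1|exact: NP].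
apply: sub_finite_set => m _; case: (ltnP (r (n, m)) (a n)) => [|le_ar].
  by left.
by right; apply/overlap_fibres; exact: leq_trans qn le_ar.
Qed.

Lemma bounding_eq_b_column_ideal_Fin_Fin :
  bounding_number #= b_ideals column_ideal Fin Fin.
Proof.
have [[F unbF bF] _] := bounding_numberP.
have wF := b_column_ideal_Fin_Fin_witness unbF.
apply/card_eqPle; split; last first.
  by rewrite (card_le_eqr bF); exact: b_ideals_le_image (countableP _) wF.
have neW : b_witness column_ideal Fin Fin !=set0 by eexists; exact: wF.
have [[W wW bW] _] := b_idealsP (countableP _) neW.
rewrite (card_le_eqr bW); apply: bounding_le_witness wW.
exact: column_ideal_finite.
Qed.

(** * Reducing witnesses on the plane to witnesses for [J] *)

(* [column_min e i] is the fibre at [i] of the partial function sending [n] to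
   the least value of [e] on the column [n]. *)
Definition column_min (e : nat -> set (nat * nat)) (i : nat) : set nat :=
  [set n | (exists m, e i (n, m)) /\ forall j m, j < i -> ~ e j (n, m)].

Lemma column_min_disjoint_seq e :
  disjoint_seq Fin e -> disjoint_seq Fin (column_min e).
Proof.
move=> [fine _]; split=> [i|i j _ _ [n [[[m im] imin] [[m' jm] jmin]]]].
  apply: sub_finite_set (finite_image fst (fine i)).
  by move=> n [[m eim] _]; exists (n, m).
case: (ltngtP i j) => // [lt_ij|lt_ji]; first by case: (jmin _ _ lt_ij im).
by case: (imin _ _ lt_ji jm).
Qed.

(** A partition [r] of [nat] lifts to [r \o fst]. The overlap of the lift with [e] has only finite
    columns, so it can leave the ideal only through its set of nonempty columns, which lies in the
    overlap of [r] with [column_min e]. *)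
Lemma column_min_witness W : b_witness column_ideal column_ideal Fin W ->
  b_witness J Fin Fin (column_min @` W).
Proof.
move=> [WFin Wit]; split=> [_ [e We <-]|A /partition_seq_fibres[r -> finr]].
  exact: column_min_disjoint_seq (WFin _ We).
have /Wit[e We ncol] : partition_seq column_ideal (fibres (r \o fst)).
  by apply: fibres_partition_seq => i; exact: (column_ideal_columns (finr i)).
exists (column_min e); [by exists e | move=> JD; apply: ncol; split].
  apply: (ideal_subset idJ) JD => n [m /overlap_fibresP[i le_ir eim]].
  have ex : exists i, `[< exists m, e i (n, m) >].
    by exists i; apply/asboolP; exists m.
  case: (ex_minnP ex) => j /asboolP ej jmin; apply/overlap_fibresP; exists j.
    by apply: leq_trans le_ir; apply: jmin; apply/asboolP; exists m.
  split=> // j' m' lt_j'j ej'.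
  suff : j <= j' by rewrite leqNgt lt_j'j.
  by apply: jmin; apply/asboolP; exists m'.
exists 0 => n _.
(* On column [n] the lift is constantly [r n], so only the finite blocks of [e] up to [r n]
   contribute. *)
have : finite_set (\bigcup_(i in `I_(r n).+1) [set m | e i (n, m)]).
  apply: bigcup_finite => [|i _]; first exact: finite_II.
  by apply: finite_column; exact: (WFin _ We).1.
by apply: sub_finite_set => m /overlap_fibresP[i le_ir eim]; exists i.
Qed.

Lemma bounding_lt_b_column_ideal_self_Fin :
  bounding_number #< b_ideals J Fin Fin ->
  bounding_number #< b_ideals column_ideal column_ideal Fin.
Proof.
move=> [bJ nJb].
have [neW|noW] := pselect (b_witness column_ideal column_ideal Fin !=set0);
  last by rewrite /b_ideals asboolF //; exact: bounding_lt_continuum_succ.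
have [[W wW bW] _] := b_idealsP (countableP _) neW.
have JW : b_ideals J Fin Fin #<= b_ideals column_ideal column_ideal Fin.
  rewrite (card_le_eqr bW).
  exact: b_ideals_le_image (countableP _) (column_min_witness wW).
split; first exact: card_le_trans JW.
by move=> Wb; apply: nJb; exact: card_le_trans Wb.
Qed.

End ColumnIdeal.

Theorem theorem8p8 :
  (exists J : set (set nat), ideal J /\ bounding_number #< b_ideals J Fin Fin) ->
  exists (X : Type) (I : set (set X)),
    [/\ countably_infinite X, weak_P_ideal I,
        b_ideals I I I #<= bounding_number,
        bounding_number #= b_ideals I Fin Fin &
        b_ideals I Fin Fin #< b_ideals I I Fin].
Proof.
move=> [J [idJ bJ]]; exists (nat * nat)%type, (column_ideal J).
have beq := bounding_eq_b_column_ideal_Fin_Fin idJ.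
split=> //.
- by split; [exact: countableP|exact: infinite_prod_nat].
- exact: column_ideal_weak_P.
- exact: b_column_ideal_self_le.
- have [le_b nle_b] := bounding_lt_b_column_ideal_self_Fin idJ bJ.
  by split; rewrite -?(card_le_eql beq) -?(card_le_eqr beq).
Qed.
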